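(* For every integer $n\ge 0$ and every positive integer $t$, $$\big|\{\gamma\in\mathcal{E}_{2n}^{1} : |\gamma|=4t\}\big|=\binom{t}{2n},$$ and $$\lim_{t\to\infty}\frac{\big|\{\gamma\in\mathcal{E}_{2n}^{1} : |\gamma|=4t\}\big|}{t^{2n}}=\frac{1}{(2n)!}.$$
   Context: Let $G=\mathbb{Z}_2*\mathbb{Z}_3$ with generators $a$ (of order two, generating the factor $\mathbb{Z}_2$) and $b$ (of order three, generating the factor $\mathbb{Z}_3$). $G$ is identified with $PSL(2,\mathbb{Z})$ via $a\mapsto A=\begin{pmatrix}0&-1\\1&0\end{pmatrix}$, $b\mapsto B=\begin{pmatrix}1&-1\\1&0\end{pmatrix}$. The modular surface is $S=\mathbb{H}/PSL(2,\mathbb{Z})$. A closed geodesic on $S$ corresponds to a conjugacy class of hyperbolic elements of $PSL(2,\mathbb{Z})$. Reciprocal geodesics: a reciprocal geodesic $\gamma$ on $S$ is a closed geodesic that begins and ends at the order two cone point of $S$; equivalently, it is a conjugacy class in $PSL(2,\mathbb{Z})$ of a hyperbolic element whose axis passes through a fixed point of an order two element. Reciprocal geodesics need not be primitive. Every reciprocal geodesic has a representative in its conjugacy class of the normal form $$ab^{\epsilon_1}\cdots ab^{\epsilon_t}\,ab^{-\epsilon_t}\cdots ab^{-\epsilon_1},\qquad \epsilon_i\in\{1,-1\},\ t\ge 1,$$ and every word of this form represents a reciprocal geodesic. Word length: $|\gamma|$ is the minimal word length, with respect to the generators $a,b,b^{-1}$ of $G$, among the elements of the conjugacy class corresponding to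 $\gamma$. For a reciprocal geodesic with normal form $ab^{\epsilon_1}\cdots ab^{\epsilon_t}\,ab^{-\epsilon_t}\cdots ab^{-\epsilon_1}$, $|\gamma|=4t$. Cusp excursions: the run sequence of a finite sequence of signs is the sequence of lengths of its maximal blocks of consecutive equal entries (for example $(1,1,1,-1,1,-1,-1,1)$ has run sequence $(3,1,1,2,1)$). For an integer $n\ge 0$, $\mathcal{E}_{2n}^{1}$ is the set of reciprocal geodesics $\gamma$ with exactly $2n$ cusp excursions of depth greater than $1$, i.e. such that the sign sequence $(\epsilon_1,\dots,\epsilon_t,-\epsilon_t,\dots,-\epsilon_1)$ of its normal form has a run sequence with exactly $2n$ parts of size at least $2$. *)

(* Defs.v *)
From HB Require Import structures.
From mathcomp Require Import all_boot all_order all_algebra.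
From mathcomp Require Import finmap complex.
From mathcomp Require Import all_classical all_reals all_analysis.

Set Implicit Arguments.
Unset Strict Implicit.
Unset Printing Implicit Defensive.

Import Order.TTheory GRing.Theory Num.Theory.
Import numFieldNormedType.Exports.

Local Open Scope classical_set_scope.
Local Open Scope ring_scope.

(* An element of PSL(2,Z) is represented by either of its two lifts M, - M in
   SL(2,Z), and a subset of PSL(2,Z) by the set of all lifts of its elements. *)

Definition mx2 (T : Type) (p q r s : T) : 'M[T]_2 :=
  \matrix_(i < 2, j < 2)
    if i == 0 then (if j == 0 then p else q) else (if j == 0 then r else s).

Definition SL2Z : set 'M[int]_2 := [set M | \det M = 1].

Definition PSL_eq (M N : 'M[int]_2) : Prop := M = N \/ M = - N.

Definition conj_class (M : 'M[int]_2) : set 'M[int]_2 :=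
  [set N | exists2 P, SL2Z P & PSL_eq N (P *m M *m invmx P)].

Definition hyperbolic (M : 'M[int]_2) : Prop := SL2Z M /\ 2 < `|\tr M|.

Definition order_two (M : 'M[int]_2) : Prop :=
  [/\ SL2Z M, ~ PSL_eq M 1%:M & PSL_eq (M *m M) 1%:M].

Definition upper_half_plane (R : realType) : set R[i] :=
  [set z | 0 < complex.Im z].

Definition mobius (R : realType) (M : 'M[int]_2) (z : R[i]) : R[i] :=
  ((M 0 0)%:~R * z + (M 0 1)%:~R) / ((M 1 0)%:~R * z + (M 1 1)%:~R).

(* The equation mobius M x = x on the real line, with the denominator cleared:
   the library's convention y / 0 = 0 would make 0 a spurious fixed point of M
   when M 1 1 = 0. *)
Definition boundary_fixpoint (R : realType) (M : 'M[int]_2) (x : R) : Prop :=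
  (M 0 0)%:~R * x + (M 0 1)%:~R = x * ((M 1 0)%:~R * x + (M 1 1)%:~R).

(* The half-circle with diameter [x1, x2]. *)
Definition hgeodesic (R : realType) (x1 x2 : R) : set R[i] :=
  [set z | upper_half_plane z /\
     (complex.Re z - x1) * (complex.Re z - x2) + complex.Im z ^+ 2 = 0].

(* A hyperbolic integer matrix has M 1 0 != 0 (otherwise its trace would be
   2 or -2), so that neither of its boundary fixed points is infinity. *)
Definition axis (R : realType) (M : 'M[int]_2) : set R[i] :=
  [set z | exists x1 x2 : R, [/\ x1 != x2, boundary_fixpoint M x1,
     boundary_fixpoint M x2 & hgeodesic x1 x2 z]].

Definition reciprocal_geodesic (R : realType) : set (set 'M[int]_2) :=
  [set g | exists M, [/\ hyperbolic M, g = conj_class M &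
     exists (T : 'M[int]_2) (z : R[i]),
       [/\ order_two T, upper_half_plane z, mobius T z = z & axis M z]]].

Inductive letter := La | Lb | Lb_inv.

Definition letter_mx (l : letter) : 'M[int]_2 :=
  match l with
  | La => mx2 0 (-1) 1 0
  | Lb => mx2 1 (-1) 1 0
  | Lb_inv => invmx (mx2 1 (-1) 1 0)
  end.

Definition word_mx (w : seq letter) : 'M[int]_2 := \prod_(l <- w) letter_mx l.

(* |g| = m *)
Definition has_word_length (g : set 'M[int]_2) (m : nat) : Prop :=
  (exists2 w, g (word_mx w) & size w = m) /\
  (forall w, g (word_mx w) -> (m <= size w)%N).

(* The signs 1 and -1 are encoded by true and false. *)
Definition sign_word (s : seq bool) : seq letter :=
  flatten [seq [:: La; if e then Lb else Lb_inv] | e <- s].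

Definition reciprocal_signs (s : seq bool) : seq bool :=
  s ++ [seq ~~ e | e <- rev s].

Fixpoint run_sequence (s : seq bool) : seq nat :=
  if s is e :: s' then
    if run_sequence s' is r :: rs then
      if e == head e s' then r.+1 :: rs else [:: 1, r & rs]%N
    else [:: 1%N]
  else [::].

Example run_sequence_ex :
  run_sequence [:: true; true; true; false; true; false; false; true]
  = [:: 3; 1; 1; 2; 1]%N.
Proof. by []. Qed.

(* A run of length at least 2 is a cusp excursion of depth greater than 1.
   A reciprocal geodesic has two normal forms; their full sign sequences are
   cyclic rotations of each other cut at sign changes, so the condition does
   not depend on the choice. *)
Definition cusp_excursions (R : realType) (k : nat) : set (set 'M[int]_2) :=
  [set g | reciprocal_geodesic R g /\
     exists s : seq bool, [/\ (0 < size s)%N,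
       g (word_mx (sign_word (reciprocal_signs s))) &
       count (leq 2) (run_sequence (reciprocal_signs s)) = k]].

Definition excursions_of_length (R : realType) (n t : nat)
    : set (set 'M[int]_2) :=
  [set g | cusp_excursions R (2 * n) g /\ has_word_length g (4 * t)].

(* Main.v *)
Require Import Defs.
From HB Require Import structures.
From mathcomp Require Import all_boot all_order all_algebra.
From mathcomp Require Import finmap complex.
From mathcomp Require Import all_classical all_reals all_analysis.
From mathcomp Require Import zify ring lra.

Import Order.TTheory GRing.Theory Num.Theory.
Import numFieldNormedType.Exports.

Local Open Scope classical_set_scope.
Local Open Scope ring_scope.

(* The reciprocal geodesics of length 4t are the classes of the full sign words
   w = (e_1, ..., e_t, - e_t, ..., - e_1).  Up to a reflection, a b and a b^-1
   are the two unipotent generators L and R of the free monoid of nonnegative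
   matrices of SL(2,Z).  A conjugation P between two words of this monoid
   becomes nonnegative after multiplication by a high power of one of them, so
   that two words are conjugate iff they are rotations of each other.  Exactly
   two rotations of w are again of the above form, hence every geodesic has two
   normal forms.  The run sequence of w is that of (e_1, ..., e_t) followed by
   its mirror image, and there are 2 * 'C(t, 2n) sequences of t signs with n
   runs of size at least 2.  The matrix of w is up to sign and reflection
   X X^T, hence symmetric, so that its axis passes through the fixed point i of
   the involution a. *)

(** * Runs of sign sequences and normal forms *)

Definition long_runs (s : seq bool) : nat := count (leq 2) (run_sequence s).

Lemma run_sequence_cons e s : run_sequence (e :: s) =
  if run_sequence s is r :: rs then
    if e == head e s then r.+1 :: rs else [:: 1, r & rs]%N
  else [:: 1%N].
Proof. by []. Qed.

(** A nonempty word has a nonempty run sequence whose first part is positive; in this form the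
    recursion loses its default branches. *)
Lemma run_sequence_consE e x s :
  exists r rs, run_sequence (x :: s) = r.+1 :: rs /\
    run_sequence (e :: x :: s) =
      if e == x then r.+2 :: rs else [:: 1, r.+1 & rs]%N.
Proof.
elim: s e x => [|y s IHs] e x; first by exists 0%N, [::].
have [r [rs [Ey Ex]]] := IHs x y.
case: (x =P y) Ex => [_|_] Ex.
  by exists r.+1, rs; split => //; rewrite run_sequence_cons Ex.
by exists 0%N, (r.+1 :: rs); split => //; rewrite run_sequence_cons Ex.
Qed.

Lemma run_sequence_cat u v :
  (u = [::]) \/ (v = [::]) \/ (last true u != head true v) ->
  run_sequence (u ++ v) = run_sequence u ++ run_sequence v.
Proof.
case=> [->//|[->|]]; first by rewrite !cats0.
case: v => [|y v]; first by rewrite !cats0.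
case: u => [|x u]; first by [].
elim: u x => [|z u IHu] x nE.
  have [r [rs [E1 E2]]] := run_sequence_consE x y v.
  by rewrite cat1s E1 E2 (negPf nE).
have [r [rs [E1 E2]]] := run_sequence_consE x z (u ++ y :: v).
have [r' [rs' [E1' E2']]] := run_sequence_consE x z u.
have := IHu z nE; rewrite !cat_cons E1 E2 E1' E2' => -[-> ->].
by case: ifP.
Qed.

Lemma run_sequence_nseq k (e : bool) : run_sequence (nseq k.+1 e) = [:: k.+1].
Proof. by elim: k => // k IHk; rewrite run_sequence_cons IHk /= eqxx. Qed.

Lemma first_run (x : bool) s : exists k s', x :: s = nseq k.+1 x ++ s' /\
  (s' = [::] \/ head true s' = ~~ x).
Proof.
elim: s x => [|y s IHs] x; first by exists 0%N, [::]; split=> //; left.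
have [k [s' [E Hs]]] := IHs y.
case: (x =P y) E Hs => [<-|nxy] E Hs.
  by exists k.+1, s'; rewrite E.
by exists 0%N, (y :: s); split => //; right; move: nxy; case: x; case: (y).
Qed.

(** The words fixed by [flip] are exactly the full sign sequences [reciprocal_signs s]. On the
    matrices [LR_mx] it becomes transposition. *)
Definition flip (s : seq bool) : seq bool := [seq ~~ e | e <- rev s].

Lemma size_flip s : size (flip s) = size s.
Proof. by rewrite size_map size_rev. Qed.

Lemma flip_cat u v : flip (u ++ v) = flip v ++ flip u.
Proof. by rewrite /flip rev_cat map_cat. Qed.

Lemma flip_rcons s x : flip (rcons s x) = ~~ x :: flip s.
Proof. by rewrite -cats1 flip_cat. Qed.

Lemma flip_cons s x : flip (x :: s) = rcons (flip s) (~~ x).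
Proof. by rewrite -cat1s flip_cat /= cats1. Qed.

Lemma flipK : involutive flip.
Proof.
by elim=> // x s IHs; rewrite flip_cons flip_rcons IHs negbK.
Qed.

(** Induction on the length: the first run is split off and becomes the last run of the flipped
    word. *)
Lemma run_sequence_flip s : run_sequence (flip s) = rev (run_sequence s).
Proof.
have [m] := ubnP (size s); elim: m s => // m IHm [|x s] // Hs.
have [k [s' [E Hs']]] := first_run x s.
rewrite E in Hs *; rewrite run_sequence_cat; last first.
  case: Hs' => [->|]; [by right; left|move=> ->; right; right].
  have -> : last true (nseq k.+1 x) = x by elim: (k).
  by case: (x).
rewrite run_sequence_nseq flip_cat rev_cat -IHm; last first.
  by move: Hs; rewrite size_cat size_nseq; lia.
have -> : flip (nseq k.+1 x) = nseq k.+1 (~~ x).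
  by rewrite /flip rev_nseq map_nseq.
rewrite run_sequence_cat ?run_sequence_nseq //.
case: Hs' => [->|]; [by left|case: s' {E Hs} => [|y s'] /=]; [by left|].
by move=> ->; right; right; rewrite flip_cons last_rcons; case: (x).
Qed.

(** The middle of a reciprocal sequence is a sign change, so no run crosses it, and the second half
    has the runs of the first in reverse order. *)
Lemma long_runs_reciprocal s :
  long_runs (reciprocal_signs s) = (2 * long_runs s)%N.
Proof.
rewrite /long_runs /reciprocal_signs -/(flip s) run_sequence_cat; last first.
  case: (lastP s) => [|u x]; [by left|right; right].
  by rewrite flip_rcons last_rcons /=; case: (x).
by rewrite run_sequence_flip count_cat count_rev mul2n addnn.
Qed.

(** A nonempty word fixed by [flip] begins and ends with opposite signs. Hence both junctions of the
    cyclic word are sign changes, and the runs of u and of v are counted separately. *)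
Lemma long_runs_catC u v :
  flip (u ++ v) = u ++ v -> flip (v ++ u) = v ++ u ->
  long_runs (v ++ u) = long_runs (u ++ v).
Proof.
have cut a b : flip (b ++ a) = b ++ a ->
    a = [::] \/ b = [::] \/ last true a != head true b.
  case: (lastP a) => [|a' x]; first by left.
  case: b => [|y b]; first by right; left.
  rewrite -rcons_cat flip_rcons cat_cons => -[<- _]; right; right.
  by rewrite last_rcons /=; case: (x).
move=> fuv fvu; rewrite /long_runs !run_sequence_cat ?count_cat; first lia.
- exact: cut.
- exact: cut.
Qed.

(** * Counting sign sequences by their number of long runs *)

Fixpoint sign_words (t : nat) : seq (seq bool) :=
  if t is t'.+1 then
    [seq true :: s | s <- sign_words t'] ++
    [seq false :: s | s <- sign_words t']
  else [:: [::]].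

Lemma mem_sign_words t s : (s \in sign_words t) = (size s == t).
Proof.
elim: t s => [|t IHt] s /=; first by rewrite inE size_eq0.
rewrite mem_cat; case: s => [|x s] /=.
  by apply/negbTE/norP; split; apply/mapP => -[].
rewrite eqSS -IHt; apply/orP/idP => [[] /mapP[s' Hs' [_ ->]] //|Hs].
by case: x; [left|right]; apply: map_f.
Qed.

Lemma uniq_sign_words t : uniq (sign_words t).
Proof.
elim: t => //= t IHt; rewrite cat_uniq !map_inj_uniq ?IHt ?andbT /=;
  try by move=> x y [].
by apply/hasPn => _ /mapP[s _ ->]; apply/mapP => -[].
Qed.

(* Prepending one of the two signs to s leaves this statistic unchanged, and
   prepending the other one increases it by 1. *)
Definition run_statistic (s : seq bool) : nat :=
  (long_runs s * 2 - (2 <= head 0 (run_sequence s)))%N.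

(** The sign that raises the statistic is x itself if the first run has length 1, and the opposite
    sign if that run is longer. *)
Lemma run_statistic_cons x s (m : nat) :
  ((run_statistic (true :: x :: s) == m) +
   (run_statistic (false :: x :: s) == m) =
  (run_statistic (x :: s) == m) + ((run_statistic (x :: s)).+1 == m))%N.
Proof.
have [r [rs [E Et]]] := run_sequence_consE true x s.
have [r' [rs' [E' Ef]]] := run_sequence_consE false x s.
move: E'; rewrite E => -[? ?]; subst r' rs'.
rewrite /run_statistic /long_runs Et Ef E.
by case: x {E Et Ef}; case: r => [|r] /=; lia.
Qed.

(** Pascal's rule, starting from the two words of one sign, whose statistic is 0. *)
Lemma count_run_statistic t m :
  count (fun s => run_statistic s == m) (sign_words t.+1) = (2 * 'C(t, m))%N.
Proof.
elim: t m => [|t IHt] m; first by case: m => [|[]].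
have -> : count (fun s => run_statistic s == m) (sign_words t.+2) =
    (count (fun s => run_statistic s == m) (sign_words t.+1) +
     count (fun s => (run_statistic s).+1 == m) (sign_words t.+1))%N.
  rewrite {1}[sign_words _]/= -/(sign_words t.+1) count_cat !count_map.
  have : all (fun s => size s == t.+1) (sign_words t.+1).
    by apply/allP => s; rewrite mem_sign_words.
  elim: (sign_words t.+1) => [|s l IHl] //= /andP[Hs Hl].
  case: s Hs => // x s _.
  have := run_statistic_cons x s m; have := IHl Hl; rewrite /=; lia.
rewrite IHt; case: m => [|m].
  by rewrite (eq_count (a2 := pred0)) ?count_pred0 ?bin0.
by rewrite (eq_count (a2 := fun s => run_statistic s == m)) // IHt binS; lia.
Qed.

(** A word with n > 0 long runs has statistic 2n - 1 or 2n according as its first run is long or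
    not, and Pascal's rule adds the two counts. *)
Lemma count_long_runs t n : (0 < t)%N ->
  count (fun s => long_runs s == n) (sign_words t) = (2 * 'C(t, 2 * n))%N.
Proof.
case: t => // t _.
have long_head s : ((2 <= head 0 (run_sequence s)) <= long_runs s)%N.
  by rewrite /long_runs; case: (run_sequence s) => //= r rs; lia.
case: n => [|n].
  have := count_run_statistic t 0; rewrite muln0 !bin0 => <-.
  apply: eq_count => s; have := long_head s; rewrite /run_statistic; lia.
have -> : (2 * n.+1 = (2 * n).+2)%N by lia.
rewrite binS mulnDr -!count_run_statistic -(count_predUI (fun s => _ == _)).
rewrite [X in (_ + X)%N](eq_count (a2 := pred0)) ?count_pred0 ?addn0; last first.
  by move=> s /=; lia.
apply: eq_count => s /=; have := long_head s; rewrite /run_statistic; lia.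
Qed.

(** Iterates of [rot 1] compose additively for all exponents, whereas [rot j] is the identity as
    soon as j exceeds the size. *)
Local Notation rot1 j := (iter j (rot 1)).

Lemma rot_iter (T : Type) j (s : seq T) : (j <= size s)%N -> rot j s = rot1 j s.
Proof.
elim: j => [|j IHj] Hj; first by rewrite rot0.
by rewrite -add1n rotD ?add1n // IHj ?iterS // ltnW.
Qed.

Lemma size_rot1 (T : Type) j (s : seq T) : size (rot1 j s) = size s.
Proof. by elim: j => //= j IHj; rewrite size_rot. Qed.

Lemma rot1_size (T : Type) (s : seq T) : rot1 (size s) s = s.
Proof. by rewrite -rot_iter ?rot_size. Qed.

Lemma rot1_period (T : Type) p m (s : seq T) :
  rot1 p s = s -> rot1 (m * p) s = s.
Proof. by move=> E; elim: m => //= m IHm; rewrite mulSn iterD IHm. Qed.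

(** Reversal turns a rotation into its inverse. *)
Lemma flip_rot s : rot 1 (flip (rot 1 s)) = flip s.
Proof. by case: s => // x s; rewrite rot1_cons flip_rcons flip_cons rot1_cons. Qed.

Lemma flip_rot1 j s : rot1 j (flip (rot1 j s)) = flip s.
Proof. by elim: j s => [|j IHj] s //; rewrite iterSr iterS flip_rot IHj. Qed.

Lemma flip_fixedP w : ~~ odd (size w) -> flip w = w ->
  w = reciprocal_signs (take (size w)./2 w).
Proof.
move=> ow fw; have sw : size w = ((size w)./2 + (size w)./2)%N by lia.
have := fw; rewrite -{1}(cat_take_drop (size w)./2 w) flip_cat.
rewrite -[RHS](cat_take_drop (size w)./2) => /eqP.
rewrite eqseq_cat; last first.
  rewrite size_flip size_drop size_takel; last by rewrite [leqRHS]sw leq_addr.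
  by rewrite [X in (X - _)%N]sw addnK.
move=> /andP[_ /eqP E].
by rewrite /reciprocal_signs -/(flip _) E cat_take_drop.
Qed.

Lemma flip_reciprocal s : flip (reciprocal_signs s) = reciprocal_signs s.
Proof. by rewrite /reciprocal_signs -/(flip s) flip_cat flipK. Qed.

Lemma size_reciprocal s : size (reciprocal_signs s) = (2 * size s)%N.
Proof. by rewrite /reciprocal_signs -/(flip s) size_cat size_flip; lia. Qed.

Lemma reciprocal_signs_inj : injective reciprocal_signs.
Proof.
move=> s s' E; have Es : size s = size s'.
  by have := congr1 size E; rewrite !size_reciprocal; lia.
move/eqP: E; rewrite /reciprocal_signs eqseq_cat //.
by case/andP=> /eqP.
Qed.

(* A rotation of w = reciprocal_signs s by j is again reciprocal iff w has
   period 2j; with j0 minimal such, these are the two rotations by 0 and j0,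
   and an odd period j0 would force a sign to equal its own negation. *)
Lemma other_normal_form s : (0 < size s)%N ->
  exists s', [/\ s' != s,
    exists j, reciprocal_signs s' = rot1 j (reciprocal_signs s) &
    forall s2, (exists j, reciprocal_signs s2 = rot1 j (reciprocal_signs s)) ->
      s2 = s \/ s2 = s'].
Proof.
move=> s0; set w := reciprocal_signs s.
have w_gt0 : (0 < size w)%N by rewrite size_reciprocal muln_gt0.
have fw : flip w = w by exact: flip_reciprocal.
have ow : ~~ odd (size w) by rewrite size_reciprocal mul2n odd_double.
pose P j := (0 < j)%N && (rot1 (2 * j) w == w).
have exP : exists j, P j.
  by exists (size s); rewrite /P s0 -size_reciprocal rot1_size eqxx.
case: (ex_minnP exP) => j0 /andP[j0_gt0 /eqP per0] min0.
have rot1_inj j : injective (iter j (@rot bool 1)).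
  by elim: j => [|j IHj] x y //= /rot_inj /IHj.
have recE j : rot1 (2 * j) w = w -> flip (rot1 j w) = rot1 j w.
  by move=> pj; apply: (rot1_inj j); rewrite flip_rot1 -iterD addnn -mul2n pj.
have recE' j : flip (rot1 j w) = rot1 j w -> rot1 (2 * j) w = w.
  by move=> pj; rewrite mul2n -addnn iterD -pj flip_rot1.
have neq : rot1 j0 w != w.
  apply/eqP => E.
  have [oj|ej] := boolP (odd j0); last first.
    have := min0 j0./2; rewrite /P.
    have -> : (2 * j0./2 = j0)%N by lia.
    rewrite E eqxx; lia.
  pose i := j0./2.
  have Ei : j0 = (i + i.+1)%N by rewrite /i; lia.
  (* Rotating w halfway along the odd period gives a word v with flip v = rot 1 v; the last sign on
     the left is the negation of that on the right. *)
  have : flip (rot1 i w) = rot 1 (rot1 i w).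
    by apply: (rot1_inj i); rewrite flip_rot1 -iterS -iterD fw -Ei.
  have : size (rot1 i w) = size w by exact: size_rot1.
  case: (rot1 i w) => [|x v] /=; first by move=> E0; rewrite -E0 in w_gt0.
  move=> _; rewrite flip_cons rot1_cons => /rcons_inj[_].
  by case: (x).
have := flip_fixedP (rot1 j0 w); rewrite size_rot1 => /(_ ow (recE _ per0)) E'.
exists (take (size w)./2 (rot1 j0 w)); split.
- by apply: contra neq => /eqP E; rewrite E' E.
- by exists j0.
move=> s2 [j Ej].
have pj : rot1 (2 * j) w = w by apply: recE'; rewrite -Ej flip_reciprocal.
(* Both 2j and 2 j0 are periods, hence so is 2 (j mod j0), and j0 is minimal. *)
have r0 : (j %% j0 = 0)%N.
  apply/eqP; apply: contraT; rewrite -lt0n => r_gt0.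
  have := min0 (j %% j0)%N; rewrite /P r_gt0 /= leqNgt ltn_mod j0_gt0 /=.
  have -> : rot1 (2 * (j %% j0)) w = w; last by rewrite eqxx => /(_ isT).
  rewrite -[in RHS]pj [in RHS](divn_eq j j0) mulnDr addnC iterD.
  by rewrite mulnCA (rot1_period _ _ _ _ per0).
(* As 2 j0 is a period, only the parity of j / j0 matters. *)
have Ej' : rot1 j w = rot1 (odd (j %/ j0) * j0)%N w.
  rewrite {1}(divn_eq j j0) r0 addn0 -{1}(odd_double_half (j %/ j0)) mulnDl.
  by rewrite iterD -muln2 -mulnA (rot1_period _ _ _ _ per0).
case: (odd (j %/ j0)) Ej' => Ej'; [right|left]; apply: reciprocal_signs_inj.
  by rewrite -E' Ej Ej' mul1n.
by rewrite Ej Ej'.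
Qed.

(** The rotation exchanges the two blocks of w cut at j mod N; both arrangements are fixed by
    [flip], so [long_runs_catC] applies. *)
Lemma long_runs_rot1 s s' j : (0 < size s)%N ->
  reciprocal_signs s' = rot1 j (reciprocal_signs s) ->
  long_runs s' = long_runs s.
Proof.
move=> s_gt0; set w := reciprocal_signs s; set N := size w.
rewrite (divn_eq j N) addnC iterD rot1_period ?rot1_size //.
rewrite -rot_iter; last by rewrite ltnW // ltn_mod /N size_reciprocal muln_gt0.
rewrite /rot => E.
have := long_runs_catC (take (j %% N) w) (drop (j %% N) w).
rewrite -E cat_take_drop !flip_reciprocal !long_runs_reciprocal => /(_ erefl erefl).
lia.
Qed.

(** * The free monoid of nonnegative matrices *)

Lemma ord2 (i : 'I_2) : (i == 0) || (i == 1).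
Proof. by case: i => -[|[|]]. Qed.

Lemma sum_ord2 (F : 'I_2 -> int) : \sum_(i < 2) F i = F 0 + F 1.
Proof. by rewrite big_ord_recl big_ord1; congr (_ + F _); exact: val_inj. Qed.

Lemma mx2E (M : 'M[int]_2) : M = mx2 (M 0 0) (M 0 1) (M 1 0) (M 1 1).
Proof.
apply/matrixP => i j; rewrite mxE.
by case/orP: (ord2 i) => /eqP->; case/orP: (ord2 j) => /eqP->.
Qed.

Lemma mx2_mul (a b c d a' b' c' d' : int) :
  mx2 a b c d * mx2 a' b' c' d' =
  mx2 (a * a' + b * c') (a * b' + b * d') (c * a' + d * c') (c * b' + d * d').
Proof.
apply/matrixP => i j; rewrite !mxE sum_ord2 !mxE /=.
by case/orP: (ord2 i) => /eqP->; case/orP: (ord2 j) => /eqP->.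
Qed.

Lemma mx2_opp (a b c d : int) : - mx2 a b c d = mx2 (- a) (- b) (- c) (- d).
Proof.
apply/matrixP => i j; rewrite !mxE.
by case/orP: (ord2 i) => /eqP->; case/orP: (ord2 j) => /eqP->.
Qed.

Lemma mx2_1 : (1 : 'M[int]_2) = mx2 1 0 0 1.
Proof.
apply/matrixP => i j; rewrite !mxE.
by case/orP: (ord2 i) => /eqP->; case/orP: (ord2 j) => /eqP->.
Qed.

Lemma mx2_inj (a b c d a' b' c' d' : int) :
  mx2 a b c d = mx2 a' b' c' d' -> [/\ a = a', b = b', c = c' & d = d'].
Proof.
move=> /matrixP E; have := (E 0 0, E 0 1, E 1 0, E 1 1).
by rewrite !mxE /= => -[[[-> ->] ->] ->].
Qed.

Lemma det_mx2_entries (M : 'M[int]_2) :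
  \det M = M 0 0 * M 1 1 - M 0 1 * M 1 0.
Proof.
rewrite (expand_det_row _ 0) sum_ord2 /cofactor !det_mx11.
rewrite !mxE /= expr0 mul1r expr1 mulN1r mulrN; congr (M _ _ * M _ _ - M _ _ * M _ _);
  exact: val_inj.
Qed.

Lemma mxtrace_mx2 (M : 'M[int]_2) : \tr M = M 0 0 + M 1 1.
Proof. exact: sum_ord2. Qed.

Lemma detM2 (M N : 'M[int]_2) : \det (M * N) = \det M * \det N.
Proof. exact: det_mulmx. Qed.

Lemma PSL_refl M : PSL_eq M M. Proof. by left. Qed.

Lemma PSL_sym {M N} : PSL_eq M N -> PSL_eq N M.
Proof. by case=> ->; [left|right; rewrite opprK]. Qed.

Lemma PSL_trans {M N K} : PSL_eq M N -> PSL_eq N K -> PSL_eq M K.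
Proof.
by case=> -> [] ->; rewrite ?opprK; [left|right|right|left].
Qed.

Lemma PSL_mul {M M' N N'} :
  PSL_eq M M' -> PSL_eq N N' -> PSL_eq (M * N) (M' * N').
Proof.
by case=> -> [] ->; rewrite ?mulrNN ?mulrN ?mulNr; [left|right|right|left].
Qed.

Lemma PSL_tr {M N} : PSL_eq M N -> `|\tr M| = `|\tr N|.
Proof. by case=> -> //; rewrite raddfN normrN. Qed.

Definition LR (e : bool) : 'M[int]_2 := if e then mx2 1 0 1 1 else mx2 1 1 0 1.

Definition LR_mx (s : seq bool) : 'M[int]_2 := \prod_(e <- s) LR e.

Lemma LR_mx_nil : LR_mx [::] = 1.
Proof. by rewrite /LR_mx big_nil. Qed.

Lemma LR_mx_cons e s : LR_mx (e :: s) = LR e * LR_mx s.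
Proof. by rewrite /LR_mx big_cons. Qed.

Lemma LR_mx_cat s s' : LR_mx (s ++ s') = LR_mx s * LR_mx s'.
Proof. by rewrite /LR_mx big_cat. Qed.

Lemma det_LR e : \det (LR e) = 1.
Proof. by case: e; rewrite det_mx2_entries !mxE. Qed.

Lemma det_LR_mx s : \det (LR_mx s) = 1.
Proof.
elim: s => [|e s IHs]; first by rewrite LR_mx_nil det1.
by rewrite LR_mx_cons detM2 IHs det_LR.
Qed.

Lemma LR_mx_cons_entries e s (j : 'I_2) :
  (LR_mx (e :: s) 0 j = LR_mx s 0 j + (if e then 0 else LR_mx s 1 j)) *
  (LR_mx (e :: s) 1 j = LR_mx s 1 j + (if e then LR_mx s 0 j else 0)).
Proof.
rewrite LR_mx_cons !mxE !sum_ord2.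
by case: e; rewrite !mxE /= ?mul1r ?mul0r ?addr0 ?add0r; split => //; rewrite addrC.
Qed.

Lemma LR_mx_ge0 s i j : 0 <= LR_mx s i j.
Proof.
elim: s i j => [|e s IHs] i j; first by rewrite LR_mx_nil mxE; case: eqP.
by case/orP: (ord2 i) => /eqP->; rewrite LR_mx_cons_entries;
  case: e; rewrite addr_ge0.
Qed.

Definition row_sum (M : 'M[int]_2) (i : 'I_2) : int := M i 0 + M i 1.

Lemma row_sum_cons e s :
  (row_sum (LR_mx (e :: s)) 0 =
    row_sum (LR_mx s) 0 + (if e then 0 else row_sum (LR_mx s) 1)) *
  (row_sum (LR_mx (e :: s)) 1 =
    row_sum (LR_mx s) 1 + (if e then row_sum (LR_mx s) 0 else 0)).
Proof. by rewrite /row_sum !LR_mx_cons_entries; case: e; split; ring. Qed.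

Lemma row_sum_gt0 s i : 0 < row_sum (LR_mx s) i.
Proof.
elim: s i => [|e s IHs] i; case/orP: (ord2 i) => /eqP->.
- by rewrite /row_sum LR_mx_nil !mxE.
- by rewrite /row_sum LR_mx_nil !mxE.
- by rewrite row_sum_cons; have := IHs 0; have := IHs 1; case: e; lia.
- by rewrite row_sum_cons; have := IHs 0; have := IHs 1; case: e; lia.
Qed.

Lemma mulrI_det1 (M X Y : 'M[int]_2) : \det M = 1 -> M * X = M * Y -> X = Y.
Proof.
move=> dM; have uM : M \in unitmx by rewrite unitmxE dM unitr1.
exact: (can_inj (mulKmx uM)).
Qed.

(* The vector of row sums follows the Calkin-Wilf tree, so that the first letter
   is read off from which of the two row sums is larger. *)
Lemma LR_mx_inj : injective LR_mx.
Proof.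
elim=> [|e s IHs] [|e' s'] // E.
- have := congr1 (row_sum^~ 0) E; have := congr1 (row_sum^~ 1) E.
  rewrite /= !row_sum_cons /row_sum LR_mx_nil !mxE /=.
  have := row_sum_gt0 s' 0; have := row_sum_gt0 s' 1; rewrite /row_sum.
  by case: e' E; lia.
- have := congr1 (row_sum^~ 0) E; have := congr1 (row_sum^~ 1) E.
  rewrite /= !row_sum_cons /row_sum LR_mx_nil !mxE /=.
  have := row_sum_gt0 s 0; have := row_sum_gt0 s 1; rewrite /row_sum.
  by case: e E; lia.
have ee' : e = e'.
  have := congr1 (row_sum^~ 0) E; have := congr1 (row_sum^~ 1) E.
  rewrite /= !row_sum_cons.
  have := row_sum_gt0 s 0; have := row_sum_gt0 s 1.
  have := row_sum_gt0 s' 0; have := row_sum_gt0 s' 1.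
  by case: e e' E => -[] // E; lia.
subst e'; congr cons; apply: IHs.
by apply: (mulrI_det1 (LR e)); rewrite ?det_LR // -!LR_mx_cons.
Qed.

(** Euclidean descent on the sum of the entries: unless M is the identity, one row dominates the
    other, and subtracting the smaller row splits off a letter. *)
Lemma LR_mx_surj (M : 'M[int]_2) : \det M = 1 -> (forall i j, 0 <= M i j) ->
  exists s, M = LR_mx s.
Proof.
move=> dM M0; rewrite (mx2E M).
move: dM (M0 0 0) (M0 0 1) (M0 1 0) (M0 1 1); rewrite det_mx2_entries.
move: (M 0 0) (M 0 1) (M 1 0) (M 1 1) => p q r s {M M0}.
have [n] := ubnP `|(p + q + r + s)%R|%N; elim: n p q r s => // n IHn p q r s.
move=> ltn dM p0 q0 r0 s0.
have [/andP[le1 le2]|nA] := boolP ((r <= p) && (s <= q)).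
  have [||||||x Ex] := IHn (p - r) (q - s) r s; [nia|nia|lia|lia|lia|lia|].
  by exists (false :: x); rewrite LR_mx_cons -Ex mx2_mul; congr mx2; ring.
have [/andP[le1 le2]|nB] := boolP ((p <= r) && (q <= s)).
  have [||||||x Ex] := IHn p q (r - p) (s - q); [nia|nia|lia|lia|lia|lia|].
  by exists (true :: x); rewrite LR_mx_cons -Ex mx2_mul; congr mx2; ring.
(* The determinant rules out the opposite crossing of the rows. Then (r + 1)(q + 1) <= p s = q r + 1
   forces q = r = 0. *)
have [lt1 lt2] : r < p /\ q < s by split; nia.
have : (r + 1) * (q + 1) <= p * s by apply: ler_pM; lia.
move=> le; have [q00 r00] : q = 0 /\ r = 0 by split; nia.
have [p1 s1] : p = 1 /\ s = 1 by move: dM; rewrite q00 r00; split; nia.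
by exists [::]; rewrite LR_mx_nil mx2_1 q00 r00 p1 s1.
Qed.

(** Transposition reverses products and exchanges the two generators. *)
Lemma trmx_LR_mx s : (LR_mx s)^T = LR_mx (flip s).
Proof.
elim: s => [|e s IHs]; first by rewrite LR_mx_nil trmx1.
rewrite LR_mx_cons flip_cons -cats1 LR_mx_cat -IHs LR_mx_cons LR_mx_nil mulr1.
rewrite [LHS]trmx_mul; congr (_ * _).
apply/matrixP => i j; rewrite /LR; case: e; rewrite !mxE;
  by case/orP: (ord2 i) => /eqP->; case/orP: (ord2 j) => /eqP->.
Qed.

(* Each letter either takes a vector out of the union of the second and fourth
   quadrants or strictly decreases its l1 norm. *)
Lemma column_descent (P : 'M[int]_2) s (j : 'I_2) :
  (`|P 0%R j| + `|P 1%R j| <= size s)%N ->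
  0 <= (LR_mx s * P) 0 j * (LR_mx s * P) 1 j.
Proof.
suff : 0 <= (LR_mx s * P) 0 j * (LR_mx s * P) 1 j \/
   (`|((LR_mx s * P) 0 j)%R| + `|((LR_mx s * P) 1 j)%R| + size s
      <= `|P 0%R j| + `|P 1%R j|)%N.
  (* The l1 norm has dropped by at least [size s], which bounds its initial value, so the vector is
     zero. *)
  case=> // H H'.
  have : (LR_mx s * P) 0 j = 0 by lia.
  by move=> ->; rewrite mul0r.
elim: s => [|e s IHs]; first by right; rewrite LR_mx_nil mul1r addn0.
move: IHs; rewrite LR_mx_cons -!mulrA; move: (LR_mx s * P) => N.
have -> : (LR e * N) 0 j = N 0 j + (if e then 0 else N 1 j).
  rewrite mxE sum_ord2.
  by case: e; rewrite !mxE /= ?mul1r ?mul0r.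
have -> : (LR e * N) 1 j = N 1 j + (if e then N 0 j else 0).
  rewrite mxE sum_ord2.
  by case: e; rewrite !mxE /= ?mul1r ?mul0r ?add0r ?addr0 1?addrC.
rewrite /= addnS; move: (N 0 j) (N 1 j) => x y.
by case: e => -[] H; rewrite ?addr0; nia.
Qed.

Lemma row_descent (P : 'M[int]_2) s (i : 'I_2) :
  (`|P i 0%R| + `|P i 1%R| <= size s)%N ->
  0 <= (P * LR_mx s) i 0 * (P * LR_mx s) i 1.
Proof.
have E : LR_mx (flip s) * P^T = (P * LR_mx s)^T.
  by rewrite -trmx_LR_mx [RHS]trmx_mul.
by have := column_descent P^T (flip s) i; rewrite size_flip E !(mxE trmx_key).
Qed.

(** Copies of s' are removed from the front of q until q is a prefix of s'; the equation then
    exhibits s and s' as the two products of the same two factors. *)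
Lemma cat_comm_rot1 (q s s' : seq bool) : (0 < size s')%N -> q ++ s = s' ++ q ->
  exists j, s' = rot1 j s.
Proof.
move=> s'_gt0; have [n] := ubnP (size q); elim: n q => // n IHn q ltn E.
have [le|lt] := leqP (size q) (size s').
  have Eq : s' = q ++ drop (size q) s'.
    have := congr1 (take (size q)) E.
    by rewrite take_size_cat // takel_cat // => {1}->; rewrite cat_take_drop.
  move: E; rewrite Eq -catA => /eqP; rewrite eqseq_cat // eqxx /= => /eqP ->.
  exists (size (drop (size q) s')).
  by rewrite -rot_iter ?size_cat ?leq_addr // rot_size_cat.
have Eq : q = s' ++ drop (size s') q.
  have := congr1 (take (size s')) E.
  by rewrite takel_cat 1?ltnW // take_size_cat // => {1}<-; rewrite cat_take_drop.
apply: (IHn (drop (size s') q)).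
  rewrite size_drop; apply: (@leq_trans (size q)) => //.
  by rewrite ltn_subrL s'_gt0 (leq_ltn_trans _ lt).
by move: E; rewrite {1}Eq -catA => /eqP; rewrite eqseq_cat // eqxx -Eq => /eqP.
Qed.

(** * Conjugacy in PSL(2,Z) *)

Lemma PSL_conj_repeat {P : 'M[int]_2} {s s'} k :
  PSL_eq (P * LR_mx s) (LR_mx s' * P) ->
  PSL_eq (P * LR_mx (flatten (nseq k s))) (LR_mx (flatten (nseq k s')) * P).
Proof.
move=> E; elim: k => [|k IHk]; first by rewrite /= LR_mx_nil mulr1 mul1r; left.
rewrite /= !LR_mx_cat mulrA; apply: PSL_trans (PSL_mul E (PSL_refl _)) _.
by rewrite -!mulrA; apply: PSL_mul IHk; exact: PSL_refl.
Qed.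

Lemma size_flatten_nseq (T : Type) k (s : seq T) :
  size (flatten (nseq k s)) = (k * size s)%N.
Proof. by elim: k => //= k IHk; rewrite size_cat IHk. Qed.

Lemma flatten_nseq_catC (T : Type) k (s : seq T) :
  flatten (nseq k s) ++ s = s ++ flatten (nseq k s).
Proof. by elim: k => [|k IHk] /=; rewrite ?cats0 // -catA IHk. Qed.

Lemma PSL_entry_mul {M N} (i j k l : 'I_2) :
  PSL_eq M N -> M i j * M k l = N i j * N k l.
Proof. by case=> -> //; rewrite !mxE mulrNN. Qed.

Lemma det1_entries_ge0 (p q r s : int) : 0 < p -> p * s - q * r = 1 ->
  0 <= p * q -> 0 <= p * r -> [/\ 0 <= q, 0 <= r & 0 <= s].
Proof.
move=> p_gt0 det; rewrite !pmulr_rge0 // => q_ge0 r_ge0; split=> //.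
by rewrite -(pmulr_rge0 _ p_gt0); have := mulr_ge0 q_ge0 r_ge0; lia.
Qed.

(* For k large, P * LR_mx s ^ k = +- LR_mx s' ^ k * P has rows and columns of
   constant sign.  If it is nonnegative up to sign it lies in the free monoid on
   the two letters, where it intertwines s and s'. *)
Lemma LR_mx_conj (P : 'M[int]_2) (s s' : seq bool) :
  \det P = 1 -> s != [::] -> s' != [::] ->
  PSL_eq (P * LR_mx s) (LR_mx s' * P) -> exists j, s' = rot1 j s.
Proof.
move=> dP s_n0 s'_n0 E.
have s_gt0 : (0 < size s)%N by rewrite lt0n size_eq0.
have s'_gt0 : (0 < size s')%N by rewrite lt0n size_eq0.
(* This k bounds the l1 norm of every row and column of P, so the k-th powers of both words are long
   enough for the descent. *)
pose k := (`|(P 0 0)%R| + `|(P 0 1)%R| + `|(P 1 0)%R| + `|(P 1 1)%R|)%N.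
have Ek := PSL_conj_repeat k E.
set Q := P * LR_mx (flatten (nseq k s)) in Ek.
have Erow i : 0 <= Q i 0 * Q i 1.
  apply: row_descent; rewrite size_flatten_nseq.
  apply: (@leq_trans k); last exact: leq_pmulr.
  by case/orP: (ord2 i) => /eqP->; rewrite /k; lia.
have Ecol j : 0 <= Q 0 j * Q 1 j.
  rewrite (PSL_entry_mul _ _ _ _ Ek).
  apply: column_descent; rewrite size_flatten_nseq.
  apply: (@leq_trans k); last exact: leq_pmulr.
  by case/orP: (ord2 j) => /eqP->; rewrite /k; lia.
have dQ : \det Q = 1 by rewrite detM2 dP det_LR_mx mul1r.
have EQ : PSL_eq (Q * LR_mx s) (LR_mx s' * Q).
  rewrite /Q -mulrA -LR_mx_cat flatten_nseq_catC LR_mx_cat !mulrA.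
  by apply: PSL_mul (PSL_refl _).
move: Q dQ EQ Erow Ecol {Ek} => Q dQ EQ Erow Ecol.
have [Q00|Q00] := eqVneq (Q 0 0) 0.
  have {Erow Ecol} [Q11 Q01] :
      Q 1 1 = 0 /\ (Q 0 1 = 1 /\ Q 1 0 = -1 \/ Q 0 1 = -1 /\ Q 1 0 = 1).
    move: dQ (Ecol 1) (Erow 1); rewrite det_mx2_entries Q00 mul0r sub0r.
    move: (Q 0 1) (Q 1 0) (Q 1 1) => x y z xy xz yz.
    have xy' : x * y = -1 by lia.
    have [[Ex Ey]|[Ex Ey]] : x = 1 /\ y = -1 \/ x = -1 /\ y = 1.
      case: (ltgtP x 0) xy' => [x0|x0|->] xy'; last by rewrite mul0r in xy'.
        have y0 : 0 < y by nia.
        by right; nia.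
      have y0 : y < 0 by nia.
      by left; nia.
      by rewrite Ex Ey in xz yz *; split; [lia|left].
    by rewrite Ex Ey in xz yz *; split; [lia|right].
  have QE : PSL_eq Q (mx2 0 1 (-1) 0).
    by rewrite [Q]mx2E Q00 Q11 /PSL_eq mx2_opp oppr0 opprK;
      case: Q01 => -[-> ->]; [left|right].
  have {}EQ : PSL_eq (mx2 0 1 (-1) 0 * LR_mx s) (LR_mx s' * mx2 0 1 (-1) 0).
    apply: PSL_trans (PSL_mul (PSL_sym QE) (PSL_refl _)) _.
    exact: PSL_trans EQ (PSL_mul (PSL_refl _) QE).
  (* Conjugation by the quarter turn exchanges the diagonal entries, and exchanges and negates the
     off-diagonal ones. For two nonnegative matrices this leaves only the identity; the opposite
     sign in [PSL_eq] would make the diagonal vanish, against determinant 1. *)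
  exfalso; move/eqP: s_n0; apply; apply: LR_mx_inj.
  rewrite LR_mx_nil mx2_1 (mx2E (LR_mx s)).
  move: EQ (det_LR_mx s) (LR_mx_ge0 s) (LR_mx_ge0 s').
  rewrite (mx2E (LR_mx s)) (mx2E (LR_mx s')) det_mx2_entries !mx2_mul /PSL_eq mx2_opp !mxE /=.
  move=> EQ dM M0 N0.
  move: EQ dM (M0 0 0) (M0 0 1) (M0 1 0) (M0 1 1)
    (N0 0 0) (N0 0 1) (N0 1 0) (N0 1 1).
  move: (LR_mx s 0 0) (LR_mx s 0 1) (LR_mx s 1 0) (LR_mx s 1 1) => a b c d.
  move: (LR_mx s' 0 0) (LR_mx s' 0 1) (LR_mx s' 1 0) (LR_mx s' 1 1).
  move=> a' b' c' d' EQ dM; rewrite !mxE /= => *.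
  case: EQ => /mx2_inj[E1 E2 E3 E4].
    have [b0 c0] : b = 0 /\ c = 0 by lia.
    have ad : a * d = 1 by rewrite -dM b0 c0; lia.
    have [a_gt0 d_gt0] : 0 < a /\ 0 < d by nia.
    have [a1 d1] : a = 1 /\ d = 1 by split; nia.
    by rewrite a1 b0 c0 d1.
  have a0 : a = 0 by lia.
  by move: dM; rewrite a0 mul0r; nia.
have [X XE X0] : exists2 X, PSL_eq Q X & forall i j, 0 <= X i j.
  have := (dQ, Erow 0, Ecol 0); rewrite det_mx2_entries => -[[d r0] c0].
  have [pos|neg] : 0 < Q 0 0 \/ 0 < - Q 0 0 by lia.
    exists Q; first exact: PSL_refl.
    have [q01 q10 q11] := det1_entries_ge0 _ _ _ _ pos d r0 c0.
    by move=> i j; case/orP: (ord2 i) => /eqP->; case/orP: (ord2 j) => /eqP->; lia.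
  exists (- Q); first by right; rewrite opprK.
  have [|||q01 q10 q11] := det1_entries_ge0 _ (- Q 0 1) (- Q 1 0) (- Q 1 1) neg;
    rewrite ?mulrNN //.
  by move=> i j; rewrite mxE;
    case/orP: (ord2 i) => /eqP->; case/orP: (ord2 j) => /eqP->;
    first [exact: ltW | done].
have dX : \det X = 1.
  by case: XE dQ => -> //; rewrite !det_mx2_entries !mxE !mulrNN.
have [q Xq] := LR_mx_surj X dX X0.
have {}EQ : PSL_eq (LR_mx (q ++ s)) (LR_mx (s' ++ q)).
  rewrite !LR_mx_cat -Xq.
  apply: PSL_trans (PSL_mul (PSL_sym XE) (PSL_refl _)) _.
  exact: PSL_trans EQ (PSL_mul (PSL_refl _) XE).
(* The positive row sums exclude the sign -, and injectivity turns the equality of matrices into one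
   of words. *)
apply: (@cat_comm_rot1 q) => //; apply: LR_mx_inj.
case: EQ => // EQ; exfalso.
have := row_sum_gt0 (q ++ s) 0; have := row_sum_gt0 (s' ++ q) 0.
by rewrite EQ /row_sum !mxE -opprD oppr_gt0 => /lt_trans H /H; rewrite ltxx.
Qed.

(** Conjugacy with the inverse cleared; [conj_classE] identifies it with membership in
    [conj_class]. *)
Definition PSL_conj (M N : 'M[int]_2) : Prop :=
  exists2 P, \det P = 1 & PSL_eq (N * P) (P * M).

Lemma PSL_conj_eq {M N} : PSL_eq M N -> PSL_conj M N.
Proof.
by move=> E; exists 1; rewrite ?det1 // mulr1 mul1r; exact: PSL_sym.
Qed.

Lemma PSL_conj_trans {M N K} : PSL_conj M N -> PSL_conj N K -> PSL_conj M K.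
Proof.
move=> [P dP E] [P' dP' E']; exists (P' * P); first by rewrite detM2 dP dP' mulr1.
rewrite mulrA; apply: PSL_trans (PSL_mul E' (PSL_refl _)) _.
by rewrite -!mulrA; apply: PSL_mul E; exact: PSL_refl.
Qed.

Lemma det1_inv {P : 'M[int]_2} : \det P = 1 ->
  [/\ \det (invmx P) = 1, P * invmx P = 1 & invmx P * P = 1].
Proof.
move=> dP; have uP : P \in unitmx by rewrite unitmxE dP unitr1.
by split; [rewrite det_inv dP invr1|exact: mulmxV|exact: mulVmx].
Qed.

Lemma PSL_conj_sym {M N} : PSL_conj M N -> PSL_conj N M.
Proof.
move=> [P dP E]; have [dV PV VP] := det1_inv dP; exists (invmx P) => //.
have := PSL_mul (PSL_refl (invmx P)) (PSL_mul E (PSL_refl (invmx P))).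
by rewrite -!mulrA PV mulr1 !mulrA VP mul1r => /PSL_sym.
Qed.

Lemma PSL_conj_mulC X Y : \det Y = 1 -> PSL_conj (X * Y) (Y * X).
Proof. by move=> dY; exists Y => //; left; rewrite mulrA. Qed.

Lemma PSL_conj_tr {M N} : PSL_conj M N -> `|\tr M| = `|\tr N|.
Proof.
move=> [P dP E]; have [dV PV VP] := det1_inv dP.
have := PSL_mul (PSL_refl (invmx P)) E; rewrite !mulrA VP mul1r => /PSL_tr <-.
by rewrite -mulrA [\tr _]mxtrace_mulC -mulmxA [X in N *m X]PV mulmx1.
Qed.

Lemma conj_classE M N : conj_class M N <-> PSL_conj M N.
Proof.
split=> -[P dP E]; have [dV PV VP] := det1_inv dP; exists P => //.
  have := PSL_mul E (PSL_refl P).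
  by rewrite -[P *m M *m invmx P]/(P * M * invmx P) -mulrA VP mulr1.
have := PSL_mul E (PSL_refl (invmx P)).
by rewrite -mulrA PV mulr1.
Qed.

Lemma conj_class_eqP M N : conj_class M = conj_class N <-> PSL_conj M N.
Proof.
split=> [E|MN].
  by apply/conj_classE; rewrite E; apply/conj_classE; exact: (PSL_conj_eq (PSL_refl _)).
apply/seteqP; split=> K /conj_classE H; apply/conj_classE.
  exact: PSL_conj_trans (PSL_conj_sym MN) H.
exact: PSL_conj_trans MN H.
Qed.

(** * Matrices of sign words *)

Lemma word_mx_cat w w' : word_mx (w ++ w') = word_mx w * word_mx w'.
Proof. by rewrite /word_mx big_cat. Qed.

Lemma word_mx_cons l w : word_mx (l :: w) = letter_mx l * word_mx w.
Proof. by rewrite /word_mx big_cons. Qed.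

Lemma letter_mx_Lb_inv : letter_mx Lb_inv = mx2 0 1 (-1) 1.
Proof.
have E : mx2 1 (-1) 1 0 * mx2 0 1 (-1) 1 = 1 :> 'M[int]_2.
  by rewrite mx2_mul mx2_1; congr mx2.
have [u _] := mulmx1_unit E.
by rewrite /= -[RHS](mulKmx u) [X in invmx _ *m X]E mulmx1.
Qed.

Definition Lb_sign (e : bool) : letter := if e then Lb else Lb_inv.

Definition sign_mx (s : seq bool) : 'M[int]_2 := word_mx (sign_word s).

Lemma sign_mx_nil : sign_mx [::] = 1.
Proof. by rewrite /sign_mx /word_mx big_nil. Qed.

Lemma sign_mx_cons e s :
  sign_mx (e :: s) = letter_mx La * letter_mx (Lb_sign e) * sign_mx s.
Proof. by rewrite /sign_mx [sign_word _]/= !word_mx_cons mulrA. Qed.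

Lemma sign_mx_cat s s' : sign_mx (s ++ s') = sign_mx s * sign_mx s'.
Proof. by rewrite /sign_mx /sign_word map_cat flatten_cat word_mx_cat. Qed.

(** Conjugation by this matrix of determinant -1 changes the signs of the off-diagonal entries,
    which makes a b and a b^-1 nonnegative up to sign. *)
Definition reflection_mx : 'M[int]_2 := mx2 1 0 0 (-1).

Lemma reflection_mxK : reflection_mx * reflection_mx = 1.
Proof. by rewrite mx2_mul mx2_1; congr mx2. Qed.

Lemma sign_mx_LR s :
  PSL_eq (sign_mx s) (reflection_mx * LR_mx s * reflection_mx).
Proof.
elim: s => [|e s IHs].
  by rewrite sign_mx_nil LR_mx_nil mulr1 reflection_mxK; left.
rewrite sign_mx_cons LR_mx_cons.
have E : PSL_eq (letter_mx La * letter_mx (Lb_sign e))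
    (reflection_mx * LR e * reflection_mx).
  case: e; rewrite /Lb_sign /LR ?letter_mx_Lb_inv /= !mx2_mul /PSL_eq mx2_opp.
    by right; congr mx2.
  by left; congr mx2.
apply: PSL_trans (PSL_mul E IHs) _; left; rewrite -!mulrA.
by rewrite (mulrA reflection_mx reflection_mx) reflection_mxK mul1r.
Qed.

Lemma det_letter_mx l : \det (letter_mx l) = 1.
Proof.
by case: l; rewrite ?letter_mx_Lb_inv det_mx2_entries !mxE.
Qed.

Lemma det_word_mx w : \det (word_mx w) = 1.
Proof.
elim: w => [|l w IHw]; first by rewrite /word_mx big_nil det1.
by rewrite word_mx_cons detM2 det_letter_mx IHw mulr1.
Qed.

(** The reflected conjugator again has determinant 1, so the statement transfers from
    [LR_mx_conj]. *)
Lemma sign_mx_conj (s s' : seq bool) : s != [::] -> s' != [::] ->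
  PSL_conj (sign_mx s) (sign_mx s') -> exists j, s' = rot1 j s.
Proof.
move=> s_n0 s'_n0 [P dP E].
apply: (LR_mx_conj (reflection_mx * P * reflection_mx)) => //.
  by rewrite !detM2 dP mulr1 -detM2 reflection_mxK det1.
have RR X : reflection_mx * (reflection_mx * X) = X.
  by rewrite mulrA reflection_mxK mul1r.
have {}E := PSL_trans (PSL_trans (PSL_mul (PSL_sym (sign_mx_LR s')) (PSL_refl P)) E)
  (PSL_mul (PSL_refl P) (sign_mx_LR s)).
have := PSL_mul (PSL_refl reflection_mx) (PSL_mul E (PSL_refl reflection_mx)).
rewrite -!mulrA RR reflection_mxK mulr1 => /PSL_sym.
by rewrite ?mulrA.
Qed.

Lemma sign_mx_rot1 j s : PSL_conj (sign_mx s) (sign_mx (rot1 j s)).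
Proof.
elim: j => [|j IHj]; first exact: (PSL_conj_eq (PSL_refl _)).
apply: PSL_conj_trans IHj _; rewrite iterS.
case: (rot1 j s) => [|e x]; first exact: (PSL_conj_eq (PSL_refl _)).
rewrite rot1_cons -cat1s -cats1 !sign_mx_cat; apply: PSL_conj_mulC.
exact: det_word_mx.
Qed.

(** * Word length *)

Lemma La_La : PSL_eq (letter_mx La * letter_mx La) 1.
Proof. by right; rewrite mx2_mul mx2_1 mx2_opp; congr mx2. Qed.

Lemma Lb_sign_sqr e :
  PSL_eq (letter_mx (Lb_sign e) * letter_mx (Lb_sign e)) (letter_mx (Lb_sign (~~ e))).
Proof.
rewrite /PSL_eq; case: e; rewrite /Lb_sign ?letter_mx_Lb_inv mx2_mul /= mx2_opp.
  by right; congr mx2.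
by right; congr mx2.
Qed.

Lemma Lb_sign_neg e : letter_mx (Lb_sign e) * letter_mx (Lb_sign (~~ e)) = 1.
Proof.
case: e; rewrite /Lb_sign ?letter_mx_Lb_inv mx2_mul mx2_1 /=; congr mx2.
Qed.

(* The element b^p a b^(u_1) ... a b^(u_k) a^q of the free product. *)
Definition reduced_mx (p : option bool) (u : seq bool) (q : bool) :=
  (if p is Some e then letter_mx (Lb_sign e) else 1) * sign_mx u *
  (if q then letter_mx La else 1).

(** Letters are prepended one at a time. A letter a starts a block in front of b^p, cancels the a of
    the first block, or toggles the final a; a letter b or b^-1 becomes b^p, or merges or cancels
    with it. *)
Lemma word_reduction w : exists p u q,
  PSL_eq (word_mx w) (reduced_mx p u q) /\
  (isSome p + 2 * size u + q <= size w)%N.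
Proof.
elim: w => [|l w [p [u [q [E le]]]]].
  exists None, [::], false; split => //.
  by rewrite /word_mx big_nil /reduced_mx sign_mx_nil !mulr1; left.
suff [p' [u' [q' [E' le']]]] : exists p' u' q',
    PSL_eq (letter_mx l * reduced_mx p u q) (reduced_mx p' u' q') /\
    (isSome p' + 2 * size u' + q' <= (isSome p + 2 * size u + q).+1)%N.
  exists p', u', q'; split; last by apply: leq_trans le' _; rewrite ltnS.
  by rewrite word_mx_cons; apply: PSL_trans (PSL_mul (PSL_refl _) E) E'.
have [->|[e ->]] : l = La \/ exists e, l = Lb_sign e.
  by case: l; [left|right; exists true|right; exists false].
- case: p {E le} => [e|].
    exists None, (e :: u), q; split; last by rewrite /=; lia.
    by rewrite /reduced_mx sign_mx_cons mul1r !mulrA; left.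
  case: u => [|e u].
    exists None, [::], (~~ q); split; last by case: q.
    rewrite /reduced_mx sign_mx_nil !mul1r.
    by case: q => /=; rewrite ?mulr1; [exact: La_La | left].
  exists (Some e), u, q; split; last by rewrite /=; lia.
  rewrite /reduced_mx sign_mx_cons mul1r !mulrA.
  do 2!apply: PSL_mul (PSL_refl _).
  by rewrite -[X in PSL_eq _ X]mul1r; apply: PSL_mul La_La (PSL_refl _).
case: p {E le} => [e'|]; last first.
  exists (Some e), u, q; split; last by rewrite /=; lia.
  by rewrite /reduced_mx mul1r !mulrA; left.
rewrite /reduced_mx !mulrA.
have [->|ne] := eqVneq e' e.
  exists (Some (~~ e)), u, q; split; last by rewrite /=; lia.
  by do 2!apply: PSL_mul (PSL_refl _); exact: Lb_sign_sqr.
have -> : e' = ~~ e by case: e e' ne => -[].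
exists None, u, q; split; last by rewrite /=; lia.
by rewrite Lb_sign_neg; left.
Qed.

(** The alternative on the trace covers the conjugates of a, b and b^-1, which no sign word
    represents; it fails for hyperbolic elements. *)
Definition cyclically_reducible (M : 'M[int]_2) (m : nat) : Prop :=
  (exists2 u, PSL_conj M (sign_mx u) & (2 * size u <= m)%N) \/ `|\tr M| <= 2.

Lemma cyclically_reducible_conj {M N m k} : PSL_conj M N -> (m <= k)%N ->
  cyclically_reducible N m -> cyclically_reducible M k.
Proof.
move=> MN mk [[u Nu le]|le]; [left; exists u|right].
- exact: PSL_conj_trans MN Nu.
- exact: leq_trans le mk.
- by rewrite (PSL_conj_tr MN).
Qed.

Lemma det_La : \det (letter_mx La) = 1. Proof. exact: det_letter_mx. Qed.

(** Conjugation brings the two ends of the word together, where they form a block, merge or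
    cancel. *)
Lemma reduced_mx_cyclic p u q :
  cyclically_reducible (reduced_mx p u q) (isSome p + 2 * size u + q).
Proof.
have [m] := ubnP (size u); elim: m p u q => // m IHm p u q ltm.
have SaE e v : cyclically_reducible (reduced_mx (Some e) v true)
    (2 * size v).+2.
  apply: (cyclically_reducible_conj (N := sign_mx (e :: v)) _ (leqnn _)).
    rewrite /reduced_mx sign_mx_cons -[X in PSL_conj _ X]mulrA.
    exact: PSL_conj_mulC det_La.
  by left; exists (e :: v); [exact: (PSL_conj_eq (PSL_refl _)) | rewrite /=; lia].
(* Without a final a, the last power of b meets the leading one. Equal signs merge into the opposite
   power; opposite signs cancel and leave a shorter word for the induction. *)
have Sb e v : (size v < m.+1)%N ->
    cyclically_reducible (reduced_mx (Some e) v false) (2 * size v).+1.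
  case: (lastP v) => [|v' e'] ltv.
    right; rewrite /reduced_mx sign_mx_nil !mulr1 mxtrace_mx2.
    by case: e; rewrite /Lb_sign ?letter_mx_Lb_inv !mxE.
  have C : PSL_conj (reduced_mx (Some e) (rcons v' e') false)
      (letter_mx (Lb_sign e') * letter_mx (Lb_sign e) * sign_mx v' * letter_mx La).
    rewrite /reduced_mx mulr1 -cats1 sign_mx_cat sign_mx_cons sign_mx_nil mulr1.
    rewrite !mulrA; apply: PSL_conj_trans (PSL_conj_mulC _ _ (det_letter_mx _)) _.
    by rewrite !mulrA; exact: (PSL_conj_eq (PSL_refl _)).
  have [ee|ne] := eqVneq e' e.
    apply: cyclically_reducible_conj (SaE (~~ e) v'); last by rewrite size_rcons; lia.
    apply: PSL_conj_trans C _; apply: PSL_conj_eq; rewrite ee /reduced_mx.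
    by do 2!apply: PSL_mul (PSL_refl _); exact: Lb_sign_sqr.
  have En : e = ~~ e' by case: e e' ne {C ltv} => -[].
  apply: cyclically_reducible_conj (IHm None v' true _).
  - apply: PSL_conj_trans C _; rewrite En Lb_sign_neg.
    exact: (PSL_conj_eq (PSL_refl _)).
  - by rewrite size_rcons /=; lia.
  - by move: ltv; rewrite size_rcons.
case: p q => [e|] [].
- by apply: cyclically_reducible_conj (PSL_conj_eq (PSL_refl _)) _ (SaE e u) => /=; lia.
- by apply: cyclically_reducible_conj (PSL_conj_eq (PSL_refl _)) _ (Sb e u ltm) => /=; lia.
- case: u ltm => [|e u] ltm.
    by right; rewrite /reduced_mx sign_mx_nil !mul1r mxtrace_mx2 !mxE.
  (* The final a is moved to the front, where it cancels the first a. *)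
  apply: cyclically_reducible_conj (Sb e u _); last by rewrite ltnW.
    rewrite /reduced_mx sign_mx_cons mul1r mulr1 -(mulrA (letter_mx La)).
    rewrite -(mulrA (letter_mx La)).
    apply: PSL_conj_trans (PSL_conj_sym (PSL_conj_mulC _ _ det_La)) _.
    apply: PSL_conj_eq; rewrite -!mulrA -[X in PSL_eq _ (_ * X)]mulr1.
    by do 2!apply: PSL_mul (PSL_refl _) _; exact: La_La.
  by rewrite /=; lia.
- left; exists u; last by rewrite /=; lia.
  by rewrite /reduced_mx mul1r mulr1; exact: (PSL_conj_eq (PSL_refl _)).
Qed.

(** * Matrices and lengths of reciprocal words *)

Lemma LR_mx_reciprocal s : LR_mx (reciprocal_signs s) = LR_mx s * (LR_mx s)^T.
Proof. by rewrite trmx_LR_mx -LR_mx_cat. Qed.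

(** The trace of X X^T is the sum of the squares of the entries of X. It exceeds 2 because X is
    nonnegative of determinant 1 and is not the identity. *)
Lemma sign_mx_reciprocal (s : seq bool) (M := sign_mx (reciprocal_signs s)) :
  s != [::] -> [/\ M 0 1 = M 1 0, M 1 0 != 0 & 2 < `|\tr M|].
Proof.
move=> s_n0; set X := LR_mx s; pose N := X * X^T.
have NE : PSL_eq M (reflection_mx * N * reflection_mx).
  by rewrite /N -LR_mx_reciprocal; exact: sign_mx_LR.
have X_n1 : ~ (X 0 0 = 1 /\ X 0 1 = 0 /\ X 1 0 = 0 /\ X 1 1 = 1).
  move=> [E00 [E01 [E10 E11]]]; move/eqP: s_n0; apply; apply: LR_mx_inj.
  by rewrite LR_mx_nil mx2_1 [LHS]mx2E -/X E00 E01 E10 E11.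
have N01 : N 0 1 = X 0 0 * X 1 0 + X 0 1 * X 1 1 by rewrite !mxE sum_ord2 !mxE.
have N10 : N 1 0 = N 0 1 by rewrite N01 !mxE sum_ord2 !mxE; ring.
have N00 : N 0 0 = X 0 0 * X 0 0 + X 0 1 * X 0 1 by rewrite !mxE sum_ord2 !mxE.
have N11 : N 1 1 = X 1 0 * X 1 0 + X 1 1 * X 1 1 by rewrite !mxE sum_ord2 !mxE.
have [N01_gt0 trN] : 0 < N 0 1 /\ 2 < N 0 0 + N 1 1.
  move: (det_LR_mx s) (LR_mx_ge0 s 0 0) (LR_mx_ge0 s 0 1) (LR_mx_ge0 s 1 0)
    (LR_mx_ge0 s 1 1) X_n1.
  rewrite det_mx2_entries -/X N01 N00 N11.
  move: (X 0 0) (X 0 1) (X 1 0) (X 1 1) => a b c d det a0 b0 c0 d0 n1.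
  have [a_gt0 d_gt0] : 0 < a /\ 0 < d by have := mulr_ge0 b0 c0; split; nia.
  have [b_gt0|c_gt0] : 0 < b \/ 0 < c.
  - have [b_gt0|b_le0] := ltrP 0 b; first by left.
    have [c_gt0|c_le0] := ltrP 0 c; first by right.
    have [bE cE] : b = 0 /\ c = 0 by lia.
    exfalso; apply: n1; move: det; rewrite bE cE mulr0 subr0 => det.
    by repeat split => //; nia.
  - by have := mulr_gt0 b_gt0 d_gt0; have := mulr_ge0 (ltW a_gt0) c0; split; nia.
  - by have := mulr_gt0 a_gt0 c_gt0; have := mulr_ge0 b0 (ltW d_gt0); split; nia.
clearbody N.
have RNR : reflection_mx * N * reflection_mx =
    mx2 (N 0 0) (- N 0 1) (- N 1 0) (N 1 1).
  by rewrite [N in LHS]mx2E !mx2_mul; congr mx2; ring.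
have trM : `|\tr M| = `|N 0 0 + N 1 1|.
  by rewrite (PSL_tr NE) RNR mxtrace_mx2 !mxE.
split; last by rewrite trM; lia.
  by case: NE => ->; rewrite RNR ?mx2_opp !mxE /= N10.
by case: NE => ->; rewrite RNR ?mx2_opp !mxE /= N10; lia.
Qed.

Lemma size_sign_word s : size (sign_word s) = (2 * size s)%N.
Proof. by elim: s => //= e s IHs; rewrite -/(sign_word s) IHs; lia. Qed.

(** Any word of the class reduces cyclically to a sign word no longer than itself, the trace
    excluding the other alternative. This sign word is a rotation of the full sign sequence of s,
    hence has the same length. *)
Lemma reciprocal_word_length (s : seq bool) : s != [::] ->
  has_word_length (conj_class (sign_mx (reciprocal_signs s))) (4 * size s).
Proof.
move=> s_n0; split.
  exists (sign_word (reciprocal_signs s)).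
    by apply/conj_classE; exact: (PSL_conj_eq (PSL_refl _)).
  by rewrite size_sign_word size_reciprocal; lia.
move=> w /conj_classE C; have [_ _ tr] := sign_mx_reciprocal s s_n0.
have [p [u [q [E le]]]] := word_reduction w.
have [[v Cv lev]|tr2] := reduced_mx_cyclic p u q; last first.
  by move: tr; rewrite (PSL_conj_tr C) (PSL_tr E) ltNge tr2.
have {E}Cv := PSL_conj_trans (PSL_conj_trans C (PSL_conj_eq E)) Cv.
have v_n0 : v != [::].
  apply/eqP => v0; move: tr; rewrite (PSL_conj_tr Cv) v0 sign_mx_nil.
  by rewrite mxtrace_mx2 !mxE.
have r_n0 : reciprocal_signs s != [::].
  by rewrite -size_eq0 size_reciprocal muln_eq0 /= size_eq0.
have [j Ej] := sign_mx_conj _ _ r_n0 v_n0 Cv.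
apply: leq_trans le; apply: leq_trans lev.
by rewrite Ej size_rot1 size_reciprocal; lia.
Qed.

(** * Counting reciprocal geodesics *)

Lemma order_two_La : order_two (letter_mx La).
Proof.
split; [exact: det_La| |exact: La_La].
by rewrite [1%:M]mx2_1 /PSL_eq mx2_opp; case=> /mx2_inj[].
Qed.

(* The boundary fixed points of a symmetric matrix have product -1, so that its
   axis passes through i. *)
Lemma symmetric_reciprocal (R : realType) (M : 'M[int]_2) :
  \det M = 1 -> M 0 1 = M 1 0 -> M 1 0 != 0 -> 2 < `|\tr M| ->
  reciprocal_geodesic R (conj_class M).
Proof.
move=> dM sM M10 trM; exists M; split => //.
exists (letter_mx La), (0 +i* 1)%C; split; first exact: order_two_La.
- by rewrite /upper_half_plane /= ltr01.
- rewrite /mobius !mxE /= mul0r add0r addr0 mul1r rmorphN1.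
  have i2 : (0 +i* 1)%C * (0 +i* 1)%C = -1 :> R[i] by rewrite -expr2 sqr_i.
  have i_n0 : (0 +i* 1)%C != 0 :> R[i].
    by apply/eqP => i0; move/eqP: i2; rewrite i0 mul0r eq_sym oppr_eq0 oner_eq0.
  by rewrite -i2 mulfK.
pose a : R := (M 0 0)%:~R; pose b : R := (M 1 0)%:~R; pose d : R := (M 1 1)%:~R.
have b_n0 : b != 0 by rewrite intr_eq0.
(* The boundary fixed points are the roots of b x^2 + (d - a) x - b = 0, whose discriminant is
   D^2. *)
pose D := Num.sqrt ((a - d) ^+ 2 + 4 * b ^+ 2).
have b2_gt0 : 0 < b ^+ 2 by rewrite exprn_even_gt0.
have disc_gt0 : 0 < (a - d) ^+ 2 + 4 * b ^+ 2.
  by apply: ltr_wpDl; [exact: sqr_ge0 | exact: mulr_gt0].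
have D2 : D ^+ 2 = (a - d) ^+ 2 + 4 * b ^+ 2 by rewrite sqr_sqrtr ?ltW.
have D_gt0 : 0 < D by rewrite sqrtr_gt0.
have fix_root e : e ^+ 2 = (a - d) ^+ 2 + 4 * b ^+ 2 ->
    boundary_fixpoint M ((a - d + e) / (2 * b)).
  move=> e2; rewrite /boundary_fixpoint sM -/a -/b -/d.
  apply/eqP; rewrite -subr_eq0; apply/eqP.
  transitivity (((a - d) ^+ 2 + 4 * b ^+ 2 - e ^+ 2) / (4 * b)); first by field.
  by rewrite e2 subrr mul0r.
exists ((a - d + D) / (2 * b)), ((a - d - D) / (2 * b)); split.
- have b2_n0 : 2 * b != 0 by rewrite mulf_neq0 ?pnatr_eq0.
  rewrite (inj_eq (mulIf (invr_neq0 b2_n0))); apply/eqP; lra.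
- exact: fix_root.
- by apply: fix_root; rewrite sqrrN.
split; first by rewrite /upper_half_plane /= ltr01.
(* At i the equation of the half-circle reads x1 x2 + 1 = 0. *)
rewrite /= !sub0r expr1n mulrNN.
transitivity (((a - d) ^+ 2 + 4 * b ^+ 2 - D ^+ 2) / (4 * b ^+ 2)); first by field.
by rewrite D2 subrr mul0r.
Qed.

Definition reciprocal_class (s : seq bool) : set 'M[int]_2 :=
  conj_class (sign_mx (reciprocal_signs s)).

Lemma reciprocal_class_eqP (s s' : seq bool) : s != [::] -> s' != [::] ->
  reciprocal_class s' = reciprocal_class s <->
  exists j, reciprocal_signs s' = rot1 j (reciprocal_signs s).
Proof.
have r_n0 (x : seq bool) : x != [::] -> reciprocal_signs x != [::].
  by move=> x_n0; rewrite -size_eq0 size_reciprocal muln_eq0 /= size_eq0.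
move=> s_n0 s'_n0; split => [E|[j Ej]].
  by apply: sign_mx_conj; rewrite ?r_n0 //; apply/conj_class_eqP; rewrite -/(reciprocal_class s) -E.
by apply/esym/conj_class_eqP; rewrite Ej; exact: sign_mx_rot1.
Qed.

Lemma has_word_length_inj g m m' :
  has_word_length g m -> has_word_length g m' -> m = m'.
Proof.
move=> [[w gw <-] minw] [[w' gw' <-] minw'].
by apply/eqP; rewrite eqn_leq minw // minw'.
Qed.

(** The word length determines the number of signs of a normal form, and the 2n long runs of the
    full sequence are n in each half. *)
Lemma excursions_of_lengthE (R : realType) n t : (0 < t)%N ->
  excursions_of_length R n t =
  [set` [seq reciprocal_class s | s <- sign_words t & long_runs s == n]].
Proof.
move=> t_gt0; apply/seteqP; split => g /=.
  move=> [[[M [hM -> _]] [s [s_gt0 gs cnt]]] len].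
  have s_n0 : s != [::] by rewrite -size_eq0 -lt0n.
  have gE : conj_class M = reciprocal_class s.
    by apply/conj_class_eqP/conj_classE.
  rewrite gE in len *; apply: map_f; rewrite mem_filter mem_sign_words.
  have := has_word_length_inj _ _ _ len (reciprocal_word_length s s_n0).
  move/eqP; rewrite eqn_pmul2l // => /eqP ->; rewrite eqxx andbT.
  by move/eqP: cnt; rewrite -/(long_runs _) long_runs_reciprocal eqn_pmul2l.
case/mapP => s; rewrite mem_filter mem_sign_words => /andP[/eqP sn /eqP st] ->.
have s_n0 : s != [::] by rewrite -size_eq0 -lt0n st.
split; last by rewrite -st; exact: reciprocal_word_length.
have [sym n0 tr] := sign_mx_reciprocal s s_n0.
split; first by apply: symmetric_reciprocal => //; exact: det_word_mx.
exists s; split; first by rewrite st.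
- by apply/conj_classE; exact: (PSL_conj_eq (PSL_refl _)).
- by rewrite -/(long_runs _) long_runs_reciprocal sn.
Qed.

(** Up to a permutation, [map f l] consists of one block of k equal values for each distinct
    value. *)
Lemma size_undup_fibers (T U : eqType) (f : T -> U) (l : seq T) k :
  {in l, forall x, count (fun y => f y == f x) l = k} ->
  size l = (k * size (undup (map f l)))%N.
Proof.
move=> fib; rewrite -(size_map f) -(perm_size (perm_count_undup _)).
rewrite size_flatten /shape -map_comp.
have : {subset undup (map f l) <= map f l} by move=> x; rewrite mem_undup.
elim: (undup _) => [|x u IHu] sub; first by rewrite muln0.
rewrite /= size_nseq IHu; last by move=> y yu; apply: sub; rewrite inE yu orbT.
have /mapP[y yl ->] : x \in map f l by apply: sub; rewrite inE eqxx.
by rewrite count_map (eq_count (a2 := fun z => f z == f y)) // fib // mulnS.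
Qed.

(** The second normal form has the same size and the same number of long runs, hence lies in the
    same list. *)
Lemma count_reciprocal_class t n (s : seq bool) : (0 < t)%N ->
  s \in [seq s <- sign_words t | long_runs s == n] ->
  count (fun s' => reciprocal_class s' == reciprocal_class s)
    [seq s <- sign_words t | long_runs s == n] = 2%N.
Proof.
move=> t_gt0; set l := seq.filter _ _ => sl.
have lP (x : seq bool) : (x \in l) = (long_runs x == n) && (size x == t).
  by rewrite mem_filter mem_sign_words.
have l_n0 (x : seq bool) : x \in l -> x != [::].
  by rewrite lP => /andP[_ /eqP xt]; rewrite -size_eq0 -lt0n xt.
have s_n0 := l_n0 _ sl; have s_gt0 : (0 < size s)%N by rewrite lt0n size_eq0.
have [s' [neq rot_s' only]] := other_normal_form s s_gt0.
have s'l : s' \in l.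
  have [j Ej] := rot_s'; move: sl; rewrite !lP (long_runs_rot1 _ _ _ s_gt0 Ej).
  have := congr1 size Ej; rewrite size_rot1 !size_reciprocal => /eqP.
  by rewrite eqn_pmul2l // => /eqP ->.
rewrite -size_filter; suff /perm_size -> : perm_eq
  [seq x <- l | reciprocal_class x == reciprocal_class s] [:: s; s'] by [].
apply: uniq_perm; rewrite ?filter_uniq ?uniq_sign_words //= ?inE ?andbT 1?eq_sym //.
move=> x; rewrite mem_filter !inE; apply/andP/orP => [[/eqP xs xl]|].
  have /only[->|->] : exists j, reciprocal_signs x = rot1 j (reciprocal_signs s).
  - by apply/reciprocal_class_eqP => //; exact: l_n0.
  - by left.
  - by right.
case=> /eqP->; split => //.
by apply/eqP/reciprocal_class_eqP => //; exact: l_n0.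
Qed.

Lemma card_excursions_of_length (R : realType) n t : (0 < t)%N ->
  #|` fset_set (excursions_of_length R n t)|%fset = 'C(t, 2 * n).
Proof.
move=> t_gt0; rewrite excursions_of_lengthE //.
set l := seq.filter _ _.
have -> : fset_set [set` map reciprocal_class l] = [fset x in map reciprocal_class l]%fset.
  by apply/fsetP => x; rewrite in_fset_set ?inE ?mem_setE //; exact: finite_seq.
rewrite card_fseq; apply/eqP; rewrite -(eqn_pmul2l (ltn0Sn 1)).
rewrite -(@size_undup_fibers _ _ reciprocal_class l 2); last first.
  by move=> s sl; exact: count_reciprocal_class.
by rewrite size_filter count_long_runs.
Qed.

(** * Asymptotics of binomial coefficients *)

Lemma cvg_inv_nat (R : realType) : ((t%:R : R)^-1) @[t --> \oo] --> (0 : R).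
Proof.
apply/gtr0_cvgV0; last exact: cvgr_idn.
by near=> t; rewrite ltr0n; near: t; exact: nbhs_infty_gt.
Unshelve. all: by end_near. Qed.

(** Induction on k: the ratio for k + 1 is the ratio for k times (1 - k / t) / (k + 1), as soon as t
    is positive and at least k. *)
Lemma cvg_binomial_ratio (R : realType) k :
  ('C(t, k)%:R / t%:R ^+ k : R) @[t --> \oo] --> ((k`!)%:R^-1 : R).
Proof.
elim: k => [|k IHk].
  by apply: cvg_near_cst; apply: nearW => t; rewrite bin0 expr0 divr1 fact0 invr1.
have lim : ('C(t, k)%:R / t%:R ^+ k * (1 - k%:R * (t%:R)^-1) * k.+1%:R^-1 : R)
    @[t --> \oo] --> (((k`!)%:R^-1 * (1 - k%:R * 0)) * k.+1%:R^-1 : R).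
  apply: cvgMl; apply: cvgM => //.
  apply: cvgB; first exact: cvg_cst.
  by apply: cvgMr; exact: cvg_inv_nat.
move: lim; rewrite mulr0 subr0 mulr1 -invfM -natrM mulnC -factS; apply: cvg_trans.
apply: near_eq_cvg; near=> t.
have t_gt0 : (0 < t)%N by near: t; exact: nbhs_infty_gt.
have kt : (k <= t)%N by near: t; exact: nbhs_infty_ge.
have t_n0 : (t%:R : R) != 0 by rewrite pnatr_eq0 -lt0n.
have k_n0 : (k.+1%:R : R) != 0 by rewrite pnatr_eq0.
have E : (k.+1%:R * 'C(t, k.+1)%:R : R) = (t%:R - k%:R) * 'C(t, k)%:R.
  by rewrite -natrB // -!natrM mul_bin_left.
have -> : ('C(t, k.+1)%:R : R) = (t%:R - k%:R) * 'C(t, k)%:R / k.+1%:R.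
  by rewrite -E mulrC mulKf.
rewrite exprS; have := expf_neq0 k t_n0.
by move: (t%:R ^+ k) => p p_n0; field; rewrite p_n0 t_n0 addrC natr1 k_n0.
Unshelve. all: by end_near. Qed.

Theorem theorem3p1 (R : realType) (n : nat) :
  (forall t : nat, (0 < t)%N ->
     finite_set (excursions_of_length R n t) /\
     #|` fset_set (excursions_of_length R n t)|%fset = 'C(t, 2 * n)) /\
  ((#|` fset_set (excursions_of_length R n t)|%fset)%:R / t%:R ^+ (2 * n) : R)
    @[t --> \oo] --> (((2 * n)`!)%:R^-1 : R).
Proof.
split=> [t t_gt0|].
  split; last exact: card_excursions_of_length.
  by rewrite excursions_of_lengthE //; exact: finite_seq.
(* The cardinality is the binomial coefficient for t > 0, so the two sequences agree eventually. *)
apply: cvg_trans (cvg_binomial_ratio R (2 * n)); apply: near_eq_cvg; near=> t.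
rewrite card_excursions_of_length //.
by near: t; exact: nbhs_infty_gt.
Unshelve. all: by end_near. Qed.
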